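(* Let $p$ be a prime, let $1\le t\le n<p$, and let $x_1,\dots,x_n\in GF(p)$ be public, pairwise distinct and nonzero. Let $S\in GF(p)$ be a secret and let $r\ge 0$ be any integer. Modify Shamir's $(t,n)$-secret sharing scheme as follows: draw $R_1,\dots,R_r$ and $a_1,\dots,a_{t-1}$ independently and uniformly at random from $GF(p)$, put $$S' = S+\sum_{i=1}^{r}R_i \bmod p,\qquad f'(x)=S'+a_1x+a_2x^2+\cdots+a_{t-1}x^{t-1}\bmod p,$$ and let the shares be $S_i=f'(x_i)$ for $1\le i\le n$ together with $R_1,\dots,R_r$. Then this is a secret sharing scheme for $S$ in which $R_1,\dots,R_r$ are crucial shares: any set of shares containing all of $R_1,\dots,R_r$ and at least $t$ of the shares $S_1,\dots,S_n$ can compute $S$, whereas for each $i\in\{1,\dots,r\}$ no set of shares that does not contain $R_i$ can compute $S$.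
   Context: $GF(p)$ is the field with $p$ elements. Shamir's $(t,n)$-secret sharing scheme: the dealer draws $a_1,\dots,a_{t-1}$ independently and uniformly from $GF(p)$, forms $f(x)=S+a_1x+\cdots+a_{t-1}x^{t-1}$ over $GF(p)$, and gives shareholder $i$ the share $S_i=f(x_i)$; the points $x_i$ are public. A set of shares ''can compute $S$'' if there is a function of the values of these shares (and of the public data $p,t,n,r,x_1,\dots,x_n$) which returns $S$ for every secret $S\in GF(p)$ and all possible values of the dealer's random choices. A share $R$ is called crucial if there exists no set $\mathcal{A}'$ of shares with $R\notin\mathcal{A}'$ such that $S$ can be computed from $\mathcal{A}'$. *)

(* Defs.v *)
From mathcomp Require Import all_boot all_order all_algebra.

Set Implicit Arguments.
Unset Strict Implicit.
Unset Printing Implicit Defensive.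

Import GRing.Theory Num.Theory.
Local Open Scope ring_scope.

(* [deal S w s] is the value of the share labelled [s] when the secret is [S]
   and the dealer's random choices, distributed according to [law], are [w].
   All public data are parameters of the scheme. *)
Record scheme (secret value : Type) (share : finType) := Scheme {
  choices : finType;
  law : choices -> rat;
  law_ge0 : forall w, 0 <= law w;
  law_sum1 : \sum_w law w = 1;
  deal : secret -> choices -> share -> value }.

Section Computability.
Variables (secret value : Type) (share : finType).
Variable D : scheme secret value share.

(* A set of shares is a set of labels. The function [g] receives the values of
   the shares in [A], each with its label, and may depend on the public data
   since these are fixed in [D]. *)
Definition can_compute (A : {set share}) : Prop :=
  exists g : {ffun {s : share | s \in A} -> value} -> secret,
  forall (S : secret) (w : choices D), 0 < law w ->
    g [ffun s => deal S w (val s)] = S.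

Definition crucial (s : share) : Prop :=
  ~ exists A' : {set share}, s \notin A' /\ can_compute A'.

End Computability.

Definition uniform (T : finType) (_ : T) : rat := #|T|%:R^-1.

(* The coefficient [a j] is the mathematical a_(j+1). *)
Definition shamir_poly (F : fieldType) (t : nat) (c : F)
    (a : {ffun 'I_t.-1 -> F}) : {poly F} :=
  c%:P + \sum_(j < t.-1) a j *: 'X^(j.+1).

Section ModifiedShamir.
Variables (p t n r : nat) (x : 'I_n -> 'F_p).

(* The values (R, a) drawn by the dealer. *)
Definition mod_choices : finType :=
  ({ffun 'I_r -> 'F_p} * {ffun 'I_t.-1 -> 'F_p})%type.

Definition mod_law (w : mod_choices) : rat :=
  (\prod_(i < r) uniform (w.1 i)) * (\prod_(j < t.-1) uniform (w.2 j)).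

(* The label [inl i] stands for the share S_(i+1), [inr i] for R_(i+1). *)
Definition mod_deal (S : 'F_p) (w : mod_choices) (s : 'I_n + 'I_r) : 'F_p :=
  match s with
  | inl i => (shamir_poly (S + \sum_(k < r) w.1 k) w.2).[x i]
  | inr i => w.1 i
  end.

Lemma mod_law_ge0 w : 0 <= mod_law w.
Proof. by apply: mulr_ge0; apply: prodr_ge0 => i _; rewrite invr_ge0 ler0n. Qed.

Lemma mod_law_sum1 : \sum_w mod_law w = 1.
Proof.
rewrite /mod_law /uniform; under eq_bigr => w _ do rewrite !prodr_const !card_ord.
rewrite sumr_const card_prod !card_ffun !card_ord -[LHS]mulr_natr natrM !natrX.
by rewrite mulrACA -!exprMn mulVf ?pnatr_eq0 // !expr1n mulr1.
Qed.

Definition modified_shamir : scheme 'F_p 'F_p ('I_n + 'I_r)%type :=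
  Scheme mod_law_ge0 mod_law_sum1 mod_deal.

End ModifiedShamir.

(* Main.v *)
Require Import Defs.
From mathcomp Require Import all_boot all_order all_algebra.

Import GRing.Theory Num.Theory.
Local Open Scope ring_scope.

(** The shares [S_i] are values of a polynomial of degree less than [t] with
    constant term [S + R_1 + ... + R_r], so [t] of them determine this term, and
    subtracting the [R_k] gives [S]. Conversely, replacing [(S, R_i)] by
    [(S + 1, R_i - 1)] leaves the constant term, hence every share other than
    [R_i], unchanged. *)

(** The function [g] searches for any secret that some choice [w] makes consistent with the observed
    values. Determinacy makes every such secret the true one, and [S0] is returned only on values
    that no deal produces. *)
Lemma can_compute_determined (secret : finType) (value : eqType)
    (share : finType) (D : scheme secret value share) (S0 : secret)
    (A : {set share}) :
  (forall S S' (w w' : choices D),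
     {in A, forall s, deal S w s = deal S' w' s} -> S = S') ->
  can_compute D A.
Proof.
move=> detA.
exists (fun v : {ffun {s : share | s \in A} -> value} =>
  odflt S0 [pick S | [exists w : choices D,
                       v == [ffun s => deal S w (val s)]]]).
move=> S w _; case: pickP => [S' /existsP[w' /eqP/ffunP eqv] | /(_ S)] /=.
  apply: (detA S' S w' w) => s sA.
  by have := eqv (exist _ s sA); rewrite !ffunE /= => ->.
(* The search cannot fail: [S] itself is consistent, witnessed by the actual choice [w]. *)
by move/negbT/existsP=> []; exists w.
Qed.

(** For the impossibility half: [g] receives the same input in both deals, yet must return both
    secrets. *)
Lemma can_compute_indistinguishable {secret value : Type} {share : finType}
    {D : scheme secret value share} {A : {set share}} {S S' : secret}
    {w w' : choices D} :
  can_compute D A -> 0 < law w -> 0 < law w' ->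
  {in A, forall s, deal S w s = deal S' w' s} -> S = S'.
Proof.
move=> [g gP] w_gt0 w'_gt0 eqA.
rewrite -(gP S w w_gt0) -(gP S' w' w'_gt0); congr g.
by apply/ffunP=> -[s sA]; rewrite !ffunE /= eqA.
Qed.

Lemma size_shamir_poly (F : fieldType) (t : nat) (c : F)
    (a : {ffun 'I_t.-1 -> F}) :
  (0 < t)%N -> (size (shamir_poly c a) <= t)%N.
Proof.
move=> t_gt0; apply: leq_trans (size_polyD _ _) _; rewrite geq_max.
rewrite (leq_trans (size_polyC_leq1 c)) //=.
apply: leq_trans (size_sum _ _ _) _; apply/bigmax_leqP => j _.
apply: leq_trans (size_scale_leq _ _) _; rewrite size_polyXn.
by rewrite -[ltnRHS]prednK // ltnS ltn_ord.
Qed.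

Lemma horner0_shamir_poly (F : fieldType) (t : nat) (c : F)
    (a : {ffun 'I_t.-1 -> F}) :
  (shamir_poly c a).[0] = c.
Proof.
rewrite hornerD hornerC horner_sum big1 ?addr0 // => j _.
by rewrite hornerZ hornerXn expr0n mulr0.
Qed.

(** A nonzero [P - Q] would have [#|B|] distinct roots while its size is at most [#|B|]. *)
Lemma poly_eq_on_points (F : idomainType) (I : finType) (x : I -> F)
    (B : {set I}) (P Q : {poly F}) :
  injective x -> (size P <= #|B|)%N -> (size Q <= #|B|)%N ->
  {in B, forall i, P.[x i] = Q.[x i]} -> P = Q.
Proof.
move=> x_inj szP szQ eqPQ; apply/eqP; rewrite -subr_eq0; apply/negPn/negP => nz.
have roots : all (root (P - Q)) [seq x i | i <- enum B].
  apply/allP => y /mapP[i]; rewrite mem_enum => iB ->.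
  by rewrite rootE hornerD hornerN eqPQ // subrr.
have := max_poly_roots nz roots; rewrite map_inj_uniq ?enum_uniq // => /(_ isT).
rewrite size_map -cardE ltnNge => /negP[].
by rewrite (leq_trans (size_polyD _ _)) // size_polyN geq_max szP.
Qed.

(** Hence any two choices of the dealer may serve as an indistinguishable pair. *)
Lemma mod_law_gt0 (p t r : nat) (w : mod_choices p t r) : 0 < mod_law w.
Proof.
have uniform_gt0 : forall y : 'F_p, 0 < uniform y.
  by move=> y; rewrite invr_gt0 ltr0n; apply/card_gt0P; exists y.
by rewrite mulr_gt0 // prodr_gt0.
Qed.

Theorem lemma3 (p t n r : nat) (x : 'I_n -> 'F_p)
    (p_prime : prime p) (t_gt0 : (1 <= t)%N) (le_tn : (t <= n)%N)
    (lt_np : (n < p)%N)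
    (x_inj : injective x) (x_neq0 : forall i, x i != 0) :
  (forall A : {set 'I_n + 'I_r},
     (forall i : 'I_r, inr i \in A) ->
     (t <= #|[set i : 'I_n | inl i \in A]|)%N ->
     can_compute (modified_shamir t r x) A)
  /\ (forall i : 'I_r, crucial (modified_shamir t r x) (inr i)).
Proof.
split=> [A RA le_tA | i [A [iA cA]]].
  apply: (can_compute_determined _ _ _ _ 0) => S S' w w' /= eqA.
  have eqR k : w.1 k = w'.1 k by exact: eqA (RA k).
  set c := S + \sum_(k < r) w.1 k; set c' := S' + \sum_(k < r) w'.1 k.
  have eqf : shamir_poly c w.2 = shamir_poly c' w'.2.
    apply: (poly_eq_on_points _ _ _ _ _ _ x_inj).
    - exact: leq_trans (size_shamir_poly _ _ _ _ t_gt0) le_tA.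
    - exact: leq_trans (size_shamir_poly _ _ _ _ t_gt0) le_tA.
    - by move=> i; rewrite inE => /eqA.
  have : c = c'.
    by rewrite -(horner0_shamir_poly _ _ c w.2) eqf horner0_shamir_poly.
  by rewrite /c /c' (eq_bigr _ (fun k _ => eqR k)) => /addIr.
(* [w] goes with the secret 0 and [w'] with the secret 1; the value -1 of [R_i] in [w'] compensates
   for the larger secret. *)
pose w : choices (modified_shamir t r x) := ([ffun=> 0], [ffun=> 0]).
pose w' : choices (modified_shamir t r x) :=
  ([ffun k => if k == i then -1 else 0], [ffun=> 0]).
suff : 0 = 1 :> 'F_p by move/esym/eqP; rewrite oner_eq0.
apply: (can_compute_indistinguishable (w := w) (w' := w') cA);
  [exact: mod_law_gt0 | exact: mod_law_gt0 | ].
case=> [j | k] sA /=; last first.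
  (* The choices differ only at [k = i], which is excluded because [inr i] is not in [A]. *)
  by rewrite !ffunE; case: eqP sA iA => // -> ->.
(* Both masked constant terms vanish: 0 + 0 and 1 + (-1). *)
congr (shamir_poly _ _).[_]; rewrite big1 => [|k _]; last by rewrite ffunE.
under eq_bigr => k _ do rewrite ffunE.
by rewrite -big_mkcond big_pred1_eq addrN addr0.
Qed.
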